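(* Let $(R,\mathfrak{m},k)$ be a Noetherian local ring with infinite residue field $k$. Let $I$ be an ideal of $R$ and let $M\subseteq N$ be finitely generated $R$-modules. Then there exist an integer $t>0$ and a nonempty Zariski open subset $U$ of the $k$-vector space $I/\mathfrak{m}I$ such that for every $x\in I$ whose image in $I/\mathfrak{m}I$ lies in $U$, and for every ideal $J$ of $R$ with $x\in J\subseteq I$, we have $$I^nM:_N J = (0:_N J)+I^{n-1}M\quad\text{for every } n\geq t.$$
   Context: For a submodule $L\subseteq N$ and an ideal $J$ of $R$, $L:_N J=\{u\in N : Ju\subseteq L\}$; in particular $0:_N J=\{u\in N: Ju=0\}$. The phrase ''for a general element $x$ of $I$'' means: for all $x\in I$ whose image in $I/\mathfrak{m}I$ lies in a suitable nonempty Zariski open subset of $I/\mathfrak{m}I$. *)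

(* Defs.v *)
From HB Require Import structures.
From mathcomp Require Import all_boot all_order all_algebra.
From mathcomp Require Import mpoly.
Set Implicit Arguments. Unset Strict Implicit. Unset Printing Implicit Defensive.
Import Order.TTheory GRing.Theory.
Local Open Scope ring_scope.

Section CommAlg.
Variable R : comNzRingType.

Definition set_eq (T : Type) (A B : T -> Prop) := forall x, A x <-> B x.
Definition subset_of (T : Type) (A B : T -> Prop) := forall x, A x -> B x.

Definition is_ideal (I : R -> Prop) :=
  [/\ I 0, (forall a b, I a -> I b -> I (a + b)) & (forall r a, I a -> I (r * a))].

Definition gen_ideal (s : seq R) : R -> Prop :=
  fun a => exists c : 'I_(size s) -> R, a = \sum_(i < size s) c i * s`_i.

Definition noetherian_ring :=
  forall I : R -> Prop, is_ideal I -> exists s : seq R, set_eq I (gen_ideal s).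

Definition proper_ideal (I : R -> Prop) := is_ideal I /\ ~ I 1.

Definition maximal_ideal (m : R -> Prop) :=
  proper_ideal m /\
  forall J, is_ideal J -> subset_of m J -> set_eq J m \/ set_eq J (fun _ => True).

Definition local_ring (m : R -> Prop) :=
  maximal_ideal m /\ forall J, maximal_ideal J -> set_eq J m.

Definition ideal_mul (A B : R -> Prop) : R -> Prop :=
  fun x => exists s : seq (R * R),
    (forall p, p \in s -> A p.1 /\ B p.2) /\ x = \sum_(p <- s) p.1 * p.2.

Fixpoint ideal_pow (I : R -> Prop) (n : nat) : R -> Prop :=
  match n with 0 => fun _ => True | n'.+1 => ideal_mul I (ideal_pow I n') end.

Definition residue_map (m : R -> Prop) (k : fieldType) (pi : {rmorphism R -> k}) :=
  (forall y : k, exists r, pi r = y) /\ (forall r, pi r = 0 <-> m r).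

Definition infinite_type (T : eqType) := ~ exists s : seq T, forall x : T, x \in s.

Variable N : lmodType R.

Definition is_submodule (L : N -> Prop) :=
  [/\ L 0, (forall u v, L u -> L v -> L (u + v)) & (forall r u, L u -> L (r *: u))].

Definition gen_submod (s : seq N) : N -> Prop :=
  fun u => exists c : 'I_(size s) -> R, u = \sum_(i < size s) c i *: s`_i.

Definition fin_gen_module := exists s : seq N, forall u, gen_submod s u.
Definition fin_gen_submodule (L : N -> Prop) := exists s : seq N, set_eq L (gen_submod s).

Definition ideal_smul (J : R -> Prop) (L : N -> Prop) : N -> Prop :=
  fun u => exists s : seq (R * N),
    (forall p, p \in s -> J p.1 /\ L p.2) /\ u = \sum_(p <- s) p.1 *: p.2.

Definition colon (L : N -> Prop) (J : R -> Prop) : N -> Prop :=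
  fun u => forall a, J a -> L (a *: u).

Definition annih (J : R -> Prop) : N -> Prop := fun u => forall a, J a -> a *: u = 0.

Definition submod_add (A B : N -> Prop) : N -> Prop :=
  fun u => exists a b, [/\ A a, B b & u = a + b].

End CommAlg.

(* phi : R -> V realizes V as the k-vector space I/mI:
   restricted to I, phi is additive, pi-semilinear, onto V, with kernel mI. *)
Definition cotangent_map (R : comNzRingType) (m : R -> Prop) (k : fieldType)
  (pi : {rmorphism R -> k}) (I : R -> Prop) (V : vectType k) (phi : R -> V) :=
  [/\ (forall a b, I a -> I b -> phi (a + b) = phi a + phi b),
      (forall r a, I a -> phi (r * a) = pi r *: phi a),
      (forall v : V, exists a, I a /\ phi a = v) &
      (forall a, I a -> (phi a = 0 <-> ideal_mul m I a))].

Definition vcoords (k : fieldType) (V : vectType k) (v : V) :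
  'I_(\dim (fullv : {vspace V})) -> k :=
  fun i => coord (vbasis fullv) i v.

Definition zariski_open (k : fieldType) (V : vectType k) (U : V -> Prop) :=
  exists S : {mpoly k[\dim (fullv : {vspace V})]} -> Prop,
    forall v, U v <-> exists p, S p /\ p.@[vcoords v] <> 0.

(* Main.v *)
Require Import Defs.
From HB Require Import structures.
From mathcomp Require Import all_boot all_order all_algebra.
From mathcomp Require Import mpoly zify.
From Stdlib Require Import Classical ClassicalEpsilon.
Local Open Scope ring_scope.
Import GRing.Theory.
Set Implicit Arguments. Unset Strict Implicit. Unset Printing Implicit Defensive.

(* Call a property of [x] in [I] generic if it holds off finitely many ideals
   properly contained in [I]; by Nakayama these have proper images in [I/mI], so a
   generic property holds on a nonempty open set. By a prime-filtration argument in
   the Rees module of [N], for families [F <= E] a generic [x] satisfies: if [u] is in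
   [E_n] and [x u] in [F_(n+1)], then [I^r u <= F_(n+r)], with [r] independent of [x].
   Three instances are used: [F = 0]; [F_n = M] inside [I^n N]; and
   [F_n = I^(n+1) M] inside [I^n M], which yields that [u] in [I^c M] and [x u] in
   [I^(n+1) M] imply [u] in [I^n M].

   To keep the bounds independent of [x], fix one generic [x0]. If [x u] is in
   [I^(n+1) M] then [x0^e u] is in [I^(n+e) M] for a fixed [e], and Artin-Rees for [x0]
   alone gives [u = z + w] with [x0^e z = 0] and [w] in [I^d M], [n - d] bounded.
   A fixed power of [I] then kills [z], while [I^n M] contains no nonzero element
   killed by that power for large [n]; hence [x z = 0], so [x w = x u] and [w] is in
   [I^n M]. The same remark applied to [a z = a u - a w], [a] in [J], gives [J z = 0]. *)

(** * Ascending chain conditions on families of predicates *)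

Section AscendingChains.
Variable T : Type.
Implicit Types (P Q : (T -> Prop) -> Prop) (L : T -> Prop).

Definition acc P :=
  forall C : nat -> T -> Prop, (forall i, P (C i)) ->
    (forall i, subset_of (C i) (C i.+1)) ->
  exists p, forall q, (p <= q)%N -> subset_of (C q) (C p).

Lemma chain_le (C : nat -> T -> Prop) :
  (forall i, subset_of (C i) (C i.+1)) ->
  forall i j, (i <= j)%N -> subset_of (C i) (C j).
Proof.
move=> incC i j /subnKC <-; elim: (j - i)%N => [|d IH] x; first by rewrite addn0.
by rewrite addnS => /IH /incC.
Qed.

Lemma acc_sub P Q : (forall L, Q L -> P L) -> acc P -> acc Q.
Proof. by move=> QP accP C QC; apply: accP => i; apply: QP. Qed.

(** Otherwise every failing member has a strictly larger failing one, and choice builds a strictly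
    ascending chain. *)
Lemma acc_ind P Q : acc P ->
  (forall L, P L -> (forall L', P L' -> subset_of L L' -> ~ subset_of L' L -> Q L') ->
     Q L) ->
  forall L, P L -> Q L.
Proof.
move=> accP step L0 PL0; apply: NNPP => nQ0.
pose S := {L | P L /\ ~ Q L}.
have next (s : S) : exists s' : S,
    subset_of (sval s) (sval s') /\ ~ subset_of (sval s') (sval s).
  case: s => L [PL nQ] /=; apply: NNPP => no; apply: nQ; apply: step => // L' PL' s1 s2.
  by apply: NNPP => nQ'; apply: no; exists (exist _ L' (conj PL' nQ')).
pose nx s := sval (constructive_indefinite_description _ (next s)).
pose s0 : S := exist _ L0 (conj PL0 nQ0).
have nxP s := svalP (constructive_indefinite_description _ (next s)).
have [p hp] := accP (fun i => sval (iter i nx s0)) (fun i => (svalP (iter i nx s0)).1)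
   (fun i => (nxP (iter i nx s0)).1).
exact: (nxP (iter p nx s0)).2 (hp p.+1 (leqnSn p)).
Qed.

Lemma acc_max P (X : (T -> Prop) -> Prop) : acc P -> (forall L, X L -> P L) ->
  (exists L, X L) ->
  exists L, X L /\ forall L', X L' -> subset_of L L' -> subset_of L' L.
Proof.
move=> accP XP [L0 XL0]; have PL0 := XP _ XL0; move: L0 PL0 XL0.
apply: (acc_ind (Q := fun L => X L -> _) accP) => L PL IH XL; apply: NNPP => no; case: (no).
exists L; split=> // L' XL' sLL'; apply: NNPP => nsub.
by case: no; apply: IH (XP _ XL') sLL' nsub XL'.
Qed.

(* A doubly increasing array stabilises along the diagonal, which controls all
   large rows; the finitely many remaining rows stabilise separately. *)
Lemma acc2 P (C : nat -> nat -> T -> Prop) : acc P ->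
  (forall j q, P (C j q)) ->
  (forall j q, subset_of (C j q) (C j.+1 q)) ->
  (forall j q, subset_of (C j q) (C j q.+1)) ->
  exists p, forall j q, (p <= q)%N -> subset_of (C j q) (C j p).
Proof.
move=> accP PC incj incq.
have incJ j j' q : (j <= j')%N -> subset_of (C j q) (C j' q).
  exact: (@chain_le (fun j => C j q)).
have incQ j q q' : (q <= q')%N -> subset_of (C j q) (C j q').
  exact: (@chain_le (C j)).
have [|p hp] := accP (fun i => C i i) (fun i => PC i i).
  by move=> i x /incj /incq.
have row (j : 'I_p) := accP (C j) (PC j) (incq j).
have [f hf] := fin_all_exists row.
pose P0 := maxn p (\max_j f j).
exists P0 => j q leq_q; have leP: (p <= P0)%N by rewrite leq_maxl.
have [ltjp|lepj] := ltnP j p.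
  have le1 : (f (Ordinal ltjp) <= P0)%N by rewrite leq_max (leq_bigmax (Ordinal ltjp)) orbT.
  move=> x Cx; apply: (incQ _ _ _ le1); apply: (hf (Ordinal ltjp)) Cx.
  exact: leq_trans le1 leq_q.
move=> x Cx; apply: (incQ _ _ _ leP); apply: (incJ _ _ _ lepj).
apply: (hp (maxn j q)); first by rewrite leq_max lepj.
by apply: (incJ j); rewrite ?leq_maxl //; apply: (incQ _ q); rewrite ?leq_maxr.
Qed.

End AscendingChains.

(** * Elementary submodule arithmetic *)

Section Modules.
Variables (R : comNzRingType) (N : lmodType R).
Implicit Types (L : N -> Prop) (u v : N) (A J : R -> Prop).

Lemma submod0 L : is_submodule L -> L 0. Proof. by case. Qed.
Lemma submodD L u v : is_submodule L -> L u -> L v -> L (u + v).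
Proof. by case=> _ + _; apply. Qed.
Lemma submodZ L a u : is_submodule L -> L u -> L (a *: u).
Proof. by case=> _ _; apply. Qed.
Lemma submodN L u : is_submodule L -> L u -> L (- u).
Proof. by move=> sL Lu; rewrite -scaleN1r; apply: submodZ. Qed.
Lemma submodB L u v : is_submodule L -> L u -> L v -> L (u - v).
Proof. by move=> sL Lu Lv; apply: submodD => //; apply: submodN. Qed.
Lemma submod_sum L (I : Type) (r : seq I) (P : pred I) (F : I -> N) :
  is_submodule L -> (forall i, P i -> L (F i)) -> L (\sum_(i <- r | P i) F i).
Proof.
move=> sL LF; elim/big_ind: _ => //; first exact: submod0.
by move=> u v; apply: submodD.
Qed.

Lemma gen_submod_submodule (s : seq N) : is_submodule (gen_submod s).
Proof.
split=> [|_ _ [c ->] [d ->]|a _ [c ->]].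
- by exists (fun=> 0); rewrite big1 // => i _; rewrite scale0r.
- by exists (fun i => c i + d i); rewrite -big_split; apply: eq_bigr => i _; rewrite scalerDl.
- by exists (fun i => a * c i); rewrite scaler_sumr; apply: eq_bigr => i _; rewrite scalerA.
Qed.

Lemma mem_gen_submod (s : seq N) u : u \in s -> gen_submod s u.
Proof.
move=> su; have iu : (index u s < size s)%N by rewrite index_mem.
exists (fun l => (l == Ordinal iu)%:R); rewrite (bigD1 (Ordinal iu)) //= eqxx scale1r.
by rewrite big1 ?addr0 ?nth_index // => l /negbTE ->; rewrite scale0r.
Qed.

Lemma gen_submod_cons (g : N) (s : seq N) u : gen_submod (g :: s) u ->
  exists a v, gen_submod s v /\ u = a *: g + v.
Proof.
case=> c ->; rewrite big_ord_recl; exists (c ord0), (\sum_(i < size s) c (lift ord0 i) *: s`_i).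
by split=> //; exists (fun i => c (lift ord0 i)).
Qed.

End Modules.

(** The union of a chain is finitely generated, and its generators all appear at one finite
    stage. *)
Lemma acc_ideals (R : comNzRingType) : noetherian_ring R -> acc (@is_ideal R).
Proof.
move=> noethR C idC incC.
have incle := chain_le incC.
have [|s sP] := noethR (fun a => exists i, C i a).
  split; first by exists 0%N; case: (idC 0%N).
    move=> a b [i Ca] [j Cb]; exists (maxn i j); case: (idC (maxn i j)) => _ + _; apply.
      by apply: incle Ca; rewrite leq_maxl.
    by apply: incle Cb; rewrite leq_maxr.
  by move=> r a [i Ca]; exists i; case: (idC i) => _ _; apply.
have sC (i : 'I_(size s)) : exists j, C j s`_i.
  by apply/sP; apply: (mem_gen_submod (N := R^o)); apply: mem_nth.
have [f hf] := fin_all_exists sC.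
exists (\max_i f i) => q _ x Cx; have [c ->] : gen_ideal s x by apply/sP; exists q.
have Cf (i : 'I_(size s)) : C (\max_i f i) s`_i.
  by apply: incle (hf i); apply: leq_bigmax.
move: (\max_i f i) Cf => p Cf; have [C0 CD CM] := idC p.
by elim/big_ind: _ => // i _; apply: CM.
Qed.

(** * Noetherian modules and products of ideals with submodules *)

Section NoetherianModules.
Variables (R : comNzRingType) (N : lmodType R).
Implicit Types (L : N -> Prop) (u v : N) (J : R -> Prop).

(** Induction on the generators: along a chain, a submodule of [R g + S] is controlled by its ideal
    of coefficients at [g] and its intersection with [S], and both stabilise. *)
Lemma acc_gen_submod (s : seq N) : noetherian_ring R ->
  acc (fun L => is_submodule L /\ subset_of L (gen_submod s)).
Proof.
move=> noethR; elim: s => [|g s IH] C PC incC.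
  exists 0%N => q _ u /((PC q).2 u) [c ->]; rewrite big_ord0.
  exact: submod0 (PC 0%N).1.
have sub_s := gen_submod_submodule s.
pose lead i a := exists v, gen_submod s v /\ C i (a *: g + v).
pose tail i v := C i v /\ gen_submod s v.
have [|i a [v [sv Cv]]|p hp] := acc_ideals noethR (C := lead).
- move=> i; have [sC _] := PC i; split.
  + by exists 0; rewrite scale0r addr0; split; apply: submod0.
  + move=> a b [v [sv Cv]] [w [sw Cw]]; exists (v + w); split; first exact: submodD.
    by rewrite scalerDl addrACA; apply: submodD.
  + move=> r a [v [sv Cv]]; exists (r *: v); split; first exact: submodZ.
    by rewrite -scalerA -scalerDr; apply: submodZ.
- by exists v; split=> //; apply: incC.
have [||p' hp'] := IH tail.
- move=> i; split=> [|u []//]; split; first by split; apply: submod0 => //; case: (PC i).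
    by move=> u v [Cu su] [Cv sv]; split; apply: submodD => //; case: (PC i).
  by move=> r u [Cu su]; split; apply: submodZ => //; case: (PC i).
- by move=> i u [Cu su]; split=> //; apply: incC.
have inc := chain_le incC.
have [lp lp'] := (leq_maxl p p', leq_maxr p p').
exists (maxn p p') => q le u Cu; have [sC _] := PC (maxn p p').
have [a [v [sv eu]]] := gen_submod_cons ((PC q).2 u Cu).
have [|v' [sv' Cv']] := hp q (leq_trans lp le) a.
  by exists v; rewrite -eu.
have Cv : tail q (v - v').
  split; last exact: submodB.
  have -> : v - v' = u - (a *: g + v') by rewrite eu opprD addrACA subrr add0r.
  by apply: submodB => //; [case: (PC q)|apply: inc Cv'; apply: leq_trans le].
have -> : u = (a *: g + v') + (v - v') by rewrite eu -addrA [v' + _]addrC subrK.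
apply: submodD => //; first exact: inc Cv'.
by apply: (inc p') => //; apply: (hp' q (leq_trans lp' le) _ Cv).1.
Qed.

Lemma acc_submodules : noetherian_ring R -> fin_gen_module N ->
  acc (@is_submodule R N).
Proof.
move=> noethR [s genN]; apply: acc_sub (acc_gen_submod (s := s) noethR) => L sL.
by split.
Qed.

Lemma ideal_smul_min J L (X : N -> Prop) : is_submodule X ->
  (forall a u, J a -> L u -> X (a *: u)) -> subset_of (ideal_smul J L) X.
Proof.
move=> sX JLX _ [s [sP ->]]; rewrite big_seq; apply: submod_sum => // p ps.
by have [] := sP p ps; apply: JLX.
Qed.

Lemma mem_ideal_smul J L a u : J a -> L u -> ideal_smul J L (a *: u).
Proof.
move=> Ja Lu; exists [:: (a, u)]; rewrite big_seq1; split=> // p.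
by rewrite inE => /eqP ->.
Qed.

Lemma ideal_smul_submod J L : is_submodule L -> is_submodule (ideal_smul J L).
Proof.
move=> sL; split; first by exists [::]; rewrite big_nil.
  move=> _ _ [s [sP ->]] [t [tP ->]]; exists (s ++ t); rewrite big_cat; split=> // p.
  by rewrite mem_cat => /orP[/sP|/tP].
move=> r _ [s [sP ->]]; exists [seq (p.1, r *: p.2) | p <- s]; rewrite big_map; split.
  by move=> _ /mapP[p ps ->] /=; have [? ?] := sP p ps; split=> //; apply: submodZ.
by rewrite scaler_sumr; apply: eq_bigr => p _; rewrite !scalerA mulrC.
Qed.

Lemma ideal_smulS J L L' : subset_of L L' -> subset_of (ideal_smul J L) (ideal_smul J L').
Proof.
by move=> sLL' u [s [sP ->]]; exists s; split=> // p /sP[? /sLL'].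
Qed.

End NoetherianModules.

(** * The chain condition for graded submodules of the Rees module *)

Section Families.
Variables (R : comNzRingType) (N : lmodType R).
Implicit Types (A : R -> Prop) (E F L : nat * N -> Prop) (u v : N).

(* A graded submodule of [N[t]] over the subalgebra of [R[t]] generated by [R]
   and the [a t] with [A a]; the pair [(n, u)] stands for [u t^n]. *)
Definition fam A L :=
  (forall n, is_submodule (fun u => L (n, u))) /\
  (forall a n u, A a -> L (n, u) -> L (n.+1, a *: u)).

Lemma fam_sub A A' L : subset_of A A' -> fam A' L -> fam A L.
Proof. by move=> sAA' [sL stL]; split=> // a n u /sAA'; apply: stL. Qed.

(* The elements [sum_(i < j) f^i g_i] of degree [n], [g_i] in [E], of [f]-degree
   less than [j]. *)
Fixpoint fspan (f : R) E (j n : nat) : N -> Prop :=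
  match j with
  | 0 => fun u => u = 0
  | j'.+1 => match n with
    | 0 => fun u => E (0%N, u)
    | n'.+1 => fun u => exists g v, [/\ E (n, g), fspan f E j' n' v & u = g + f *: v]
    end
  end.

(** In degree [n] no power of [f] above the [n]-th can occur, so the bound [n.+1] is no
    restriction. *)
Definition adjoin f E (nu : nat * N) := fspan f E nu.1.+1 nu.1 nu.2.

Section Adjoin.
Variables (A : R -> Prop) (f : R) (E : nat * N -> Prop).
Hypothesis famE : fam A E.

Let E0 n : E (n, 0). Proof. exact: submod0 (famE.1 n). Qed.

Lemma fspan_submod j n : is_submodule (fspan f E j n).
Proof.
elim: j n => [|j IH] n; first by split=> [//|_ _ -> ->|r _ ->]; rewrite ?addr0 ?scaler0.
case: n => [|n]; first exact: famE.1.
have sE := famE.1 n.+1; have sD := IH n; split.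
- by exists 0, 0; rewrite scaler0 addr0; split=> //; apply: submod0 sD.
- move=> _ _ [g [v [Eg Dv ->]]] [h [w [Eh Dw ->]]]; exists (g + h), (v + w).
  by rewrite scalerDr addrACA; split=> //; [apply: (submodD sE)|apply: submodD].
- move=> r _ [g [v [Eg Dv ->]]]; exists (r *: g), (r *: v).
  rewrite scalerDr !scalerA [f * r]mulrC.
  by split=> //; [apply: (submodZ _ sE)|apply: submodZ].
Qed.

Lemma fspan_mono j n u : fspan f E j n u -> fspan f E j.+1 n u.
Proof.
elim: j n u => [|j IH] n u; first by move=> ->; apply: (submod0 (fspan_submod _ _)).
case: n => // n [g [v [Eg Dv ->]]]; exists g, v; split=> //; exact: IH.
Qed.

Lemma fspan_f j n u : fspan f E j n u -> fspan f E j.+1 n.+1 (f *: u).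
Proof. by move=> Du; exists 0, u; rewrite add0r. Qed.

Lemma fspan_A a j n u : A a -> fspan f E j n u -> fspan f E j n.+1 (a *: u).
Proof.
move=> Aa; elim: j n u => [|j IH] n u; first by move=> ->; rewrite /= scaler0.
case: n => [Eu|n [g [v [Eg Dv ->]]]].
  exists (a *: u), 0; rewrite scaler0 addr0; split=> //; first exact: famE.2.
  exact: (submod0 (fspan_submod j 0)).
exists (a *: g), (a *: v); rewrite scalerDr !scalerA [f * a]mulrC.
by split=> //; [apply: famE.2|apply: IH].
Qed.

Lemma fspan_top j n u : fspan f E j.+1 (n + j) u ->
  exists g v, [/\ E (n, g), fspan f E j (n + j) v & u = f ^+ j *: g + v].
Proof.
elim: j u => [|j IH] u.
  rewrite addn0; case: n => [Eu|n [g [v [Eg -> ->]]]].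
    by exists u, 0; rewrite expr0 scale1r addr0.
  by exists g, 0; rewrite expr0 scale1r scaler0.
rewrite addnS => -[h [w [Eh /IH[g [v [Eg Dv ->]]] ->]]].
exists g, (h + f *: v); split=> //; first by exists h, v.
by rewrite scalerDr scalerA -exprS addrCA.
Qed.

Lemma fam_adjoin : fam (fun a => a = f \/ A a) (adjoin f E).
Proof.
split=> [n|a n u [->|Aa]]; first exact: fspan_submod.
  exact: fspan_f.
by move=> Du; apply/fspan_mono/fspan_A.
Qed.

(** Leading coefficients at [f ^+ j], graded by their own degree [n]; the element of [L] that
    carries them has degree [n + j]. *)
Definition lead j L (nu : nat * N) :=
  E nu /\ exists v, fspan f E j (nu.1 + j) v /\ L ((nu.1 + j)%N, f ^+ j *: nu.2 + v).

Lemma fam_lead j L : fam (fun a => a = f \/ A a) L -> fam A (lead j L).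
Proof.
move=> [sL stL]; split=> [n|a n u Aa [Eu [v /= [Dv Lv]]]]; last first.
  split; first exact: famE.2.
  exists (a *: v); split; first exact: fspan_A.
  by rewrite /= scalerA mulrC -scalerA -scalerDr; apply: stL => //; right.
have sE := famE.1 n; have sD := fspan_submod j (n + j); have sLn := sL (n + j)%N.
split.
- split=> //; exists 0; rewrite scaler0 addr0; split; first exact: submod0 sD.
  exact: submod0 sLn.
- move=> u u' [Eu [v [Dv Lv]]] [Eu' [v' [Dv' Lv']]]; split; first exact: (submodD sE).
  exists (v + v'); split; first exact: submodD.
  by rewrite /= scalerDr addrACA; apply: (submodD sLn).
- move=> r u [Eu [v [Dv Lv]]]; split; first exact: (submodZ _ sE).
  exists (r *: v); split; first exact: submodZ.
  by rewrite /= scalerA mulrC -scalerA -scalerDr; apply: (submodZ _ sLn).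
Qed.

Lemma lead_mono j L : fam (fun a => a = f \/ A a) L ->
  subset_of (lead j L) (lead j.+1 L).
Proof.
move=> [sL stL] [n u] [Eu [v /= [Dv Lv]]]; split=> //; exists (f *: v).
rewrite /= addnS exprS -scalerA -scalerDr; split; first exact: fspan_f.
by apply: stL => //; left.
Qed.

Lemma lead_sub j L L' : subset_of L L' -> subset_of (lead j L) (lead j L').
Proof. by move=> sLL' nu [Enu [v [Dv Lv]]]; split=> //; exists v; split=> //; apply: sLL'. Qed.

(** Subtracting from an element of [L'] an element of [L] with the same leading coefficient lowers
    the [f]-degree, so induction on that degree applies. *)
Lemma sub_of_lead L L' : fam (fun a => a = f \/ A a) L ->
  fam (fun a => a = f \/ A a) L' -> subset_of L L' -> subset_of L' (adjoin f E) ->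
  (forall j, subset_of (lead j L') (lead j L)) -> subset_of L' L.
Proof.
move=> [sL _] [sL' _] sLL' sL'E lead_eq [n u] L'u.
suff main j : (j <= n.+1)%N -> forall u, fspan f E j n u -> L' (n, u) -> L (n, u).
  by apply: (main n.+1) => //; apply: sL'E L'u.
elim: j => [|j IH] ltjn {L'u}u Du L'u; first by rewrite Du; apply: submod0 (sL n).
have en : n = ((n - j) + j)%N by rewrite subnK.
have [|g [v [Eg Dv eu]]] := @fspan_top j (n - j) u; first by rewrite -en.
have [|_ [v' []]] := lead_eq j ((n - j)%N, g).
  by split=> //; exists v; rewrite /= -en -eu; rewrite -en in Dv.
rewrite /= -!en => Dv' Lv'; rewrite -en in Dv.
have -> : u = (f ^+ j *: g + v') + (v - v') by rewrite eu -addrA [v' + _]addrC subrK.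
apply: (submodD (sL n)) => //; apply: IH (ltnW ltjn) _ _ _.
  by apply: submodB => //; apply: fspan_submod.
have -> : v - v' = u - (f ^+ j *: g + v') by rewrite eu opprD addrACA subrr add0r.
by apply: (submodB (sL' n)) => //; apply: sLL'.
Qed.

(* Hilbert's basis argument: a family is controlled by its leading coefficients. *)
Lemma acc_adjoin : acc (fun L => fam A L /\ subset_of L E) ->
  acc (fun L => fam (fun a => a = f \/ A a) L /\ subset_of L (adjoin f E)).
Proof.
move=> accE C PC incC.
have [|||p hp] := acc2 accE (C := fun j q => lead j (C q)).
- by move=> j q; split; [apply: fam_lead; case: (PC q)|move=> nu []].
- by move=> j q; apply: lead_mono; case: (PC q).
- by move=> j q; apply: lead_sub.
exists p => q lepq; apply: sub_of_lead (PC p).1 (PC q).1 _ (PC q).2 _.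
  exact: chain_le incC _ _ lepq.
by move=> j; apply: hp.
Qed.

End Adjoin.

(** This is [I^n L], iterated so that inductions handle one factor of [I] at a time; [pw_ideal_pow]
    links it to [ideal_pow]. *)
Definition pw (I : R -> Prop) (L : N -> Prop) n := iter n (ideal_smul I) L.

(** Starting from [N] in degree 0, the generators of [I] are adjoined one by one, each preserving
    the chain condition by [acc_adjoin]. *)
Lemma acc_rees (I : R -> Prop) : noetherian_ring R -> fin_gen_module N -> is_ideal I ->
  acc (fun L => fam I L /\ forall n u, L (n, u) -> pw I (fun _ => True) n u).
Proof.
move=> noethR fgN idI; have [s sP] := noethR I idI.
have [E [famE E1 accE]] : exists E, [/\ fam (fun a => a \in s) E,
    forall u, E (0%N, u) & acc (fun L => fam (fun a => a \in s) L /\ subset_of L E)].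
  elim: s {sP} => [|f s [E [famE E1 accE]]].
    (* With nothing adjoined yet, a family inside this one is just a submodule of [N] in degree
       0. *)
    exists (fun nu => nu.1 = 0%N \/ nu.2 = 0); split.
    - split=> [n|//]; split=> [|u v [/= ->|/= ->]|r u [/= ->|/= ->]]; rewrite ?scaler0 ?add0r.
      + by right.
      + by left.
      + by [].
      + by left.
      + by right.
    - by move=> u; left.
    - move=> C PC incC.
      have [i|i u|p hp] := acc_submodules noethR fgN (C := fun i u => C i (0%N, u)).
      + exact: (PC i).1.1.
      + exact: incC.
      exists p => q lepq [n u] Cu; case: ((PC q).2 _ Cu) => /= e.
        by move: Cu; rewrite e; apply: hp.
      by rewrite e; apply: submod0 ((PC p).1.1 n).
  have sub1 : subset_of (fun a => a \in f :: s) (fun a => a = f \/ a \in s).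
    by move=> a; rewrite inE => /orP[/eqP|]; [left|right].
  have sub2 : subset_of (fun a => a = f \/ a \in s) (fun a => a \in f :: s).
    by move=> a; rewrite inE => -[->|->]; rewrite ?eqxx ?orbT.
  exists (adjoin f E); split; [exact: fam_sub sub1 (fam_adjoin f famE)|exact: E1|].
  apply: acc_sub (acc_adjoin (f := f) famE accE) => L [fL sL]; split=> //.
  exact: fam_sub fL.
apply: acc_sub accE => L [fL sL]; split.
  by apply: fam_sub fL => a sa; apply/sP; apply: (mem_gen_submod (N := R^o)).
(* Containing [N] in degree 0 and being closed under the generators of [I] forces [E] to contain the
   whole Rees module. *)
suff pwE n u : pw I (fun _ => True) n u -> E (n, u) by move=> [n u] /sL /pwE.
elim: n u => [|n IH] u; first by move=> _; apply: E1.
have sE := famE.1 n.+1; apply: (ideal_smul_min sE) => a v /sP[c ->] /IH Ev.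
rewrite scaler_suml; apply: (submod_sum _ sE) => i _.
by rewrite -scalerA; apply: (submodZ _ sE); apply: famE.2 => //; apply: mem_nth.
Qed.

End Families.

(** * Powers of [I], elements killed by them, and Artin-Rees *)

Section Powers.
Variables (R : comNzRingType) (N : lmodType R) (I : R -> Prop).
Implicit Types (E F H : nat * N -> Prop) (L : N -> Prop) (u v : N).
Local Notation pw := (pw I).
Local Notation fam := (fam I).

Lemma pw_submod L n : is_submodule L -> is_submodule (pw L n).
Proof. by move=> sL; elim: n => // n IH; apply: ideal_smul_submod. Qed.

Lemma fam_pw L : is_submodule L -> fam (fun nu => pw L nu.1 nu.2).
Proof.
by move=> sL; split=> [n|a n u Ia Lu]; [apply: pw_submod|apply: mem_ideal_smul].
Qed.

Lemma pwS L L' n : subset_of L L' -> subset_of (pw L n) (pw L' n).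
Proof. by move=> sLL'; elim: n => // n IH; apply: ideal_smulS. Qed.

Lemma pw_add L m n : pw L (m + n) = pw (pw L n) m.
Proof. exact: iterD. Qed.

Lemma pw_le L m n : is_submodule L -> (m <= n)%N -> subset_of (pw L n) (pw L m).
Proof.
move=> sL /subnK <-; rewrite addnC pw_add; apply: pwS => u.
elim: (n - m)%N u => // d IH; apply: ideal_smul_min => // a u _ /IH.
exact: submodZ.
Qed.

Lemma pw_min F L n d u : fam F -> (forall v, L v -> F (n, v)) -> pw L d u ->
  F ((n + d)%N, u).
Proof.
move=> [sF stF] LF; elim: d u => [|d IH] u; first by rewrite addn0; apply: LF.
rewrite addnS; apply: (ideal_smul_min (sF _)) => a v Ia /IH; exact: stF.
Qed.

Lemma pw_pow L x n u : I x -> L u -> pw L n (x ^+ n *: u).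
Proof.
move=> Ix Lu; elim: n => [|n IH]; first by rewrite expr0 scale1r.
by rewrite exprS -scalerA; apply: mem_ideal_smul.
Qed.

Lemma ideal_smul_mul (J K : R -> Prop) L : is_submodule L ->
  set_eq (ideal_smul (ideal_mul J K) L) (ideal_smul J (ideal_smul K L)).
Proof.
move=> sL u; have sKL := ideal_smul_submod K sL; split.
  apply: ideal_smul_min; first exact: ideal_smul_submod.
  move=> _ v [s [sP ->]] Lv; rewrite scaler_suml big_seq.
  apply: (submod_sum _ (ideal_smul_submod J sKL)) => p /sP[Jp Kp].
  by rewrite -scalerA; apply: mem_ideal_smul => //; apply: mem_ideal_smul.
have sX := ideal_smul_submod (ideal_mul J K) sL.
apply: ideal_smul_min => // a _ Ja [s [sP ->]]; rewrite scaler_sumr big_seq.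
apply: (submod_sum _ sX) => p /sP[Kp Lp]; rewrite scalerA; apply: mem_ideal_smul => //.
by exists [:: (a, p.1)]; rewrite big_seq1; split=> // q; rewrite inE => /eqP ->.
Qed.

Lemma pw_ideal_pow L n : is_submodule L ->
  set_eq (ideal_smul (ideal_pow I n) L) (pw L n).
Proof.
move=> sL; elim: n => [|n IH] u.
  split=> [|Lu]; first by apply: ideal_smul_min => // a v _; apply: submodZ.
  by rewrite -[u]scale1r; apply: mem_ideal_smul.
by rewrite ideal_smul_mul //; split; apply: ideal_smulS => v /IH.
Qed.

(* [I^r u] is contained in [F_(n+r)]. *)
Fixpoint kills F r n u :=
  if r is r'.+1 then forall a, I a -> kills F r' n.+1 (a *: u) else F (n, u).

Lemma kills_shift F F' r m n u : (forall i v, F ((m + i)%N, v) -> F' ((n + i)%N, v)) ->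
  kills F r m u -> kills F' r n u.
Proof.
elim: r m n u => [|r IH] m n u FF'; first by move: (FF' 0%N u); rewrite !addn0.
by move=> Ku a Ia; apply: IH (Ku a Ia) => i v; rewrite !addSnnS; apply: FF'.
Qed.

Lemma kills_comp F F' r s n u : (forall n v, F (n, v) -> kills F' s n v) ->
  kills F r n u -> kills F' (r + s) n u.
Proof.
by move=> FF'; elim: r n u => [|r IH] n u; [apply: FF'|move=> Ku a Ia; apply/IH/Ku].
Qed.

Lemma kills_scale F b r n u : kills F r n (b *: u) ->
  kills (fun nu => F (nu.1, b *: nu.2)) r n u.
Proof.
elim: r n u => // r IH n u Ku a Ia; apply: IH.
by rewrite scalerA mulrC -scalerA; apply: Ku.
Qed.

Lemma kills_pow F x r n u : I x -> kills F r n u -> F ((n + r)%N, x ^+ r *: u).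
Proof.
move=> Ix; elim: r n u => [|r IH] n u; first by rewrite addn0 expr0 scale1r.
by move=> /(_ x Ix) /IH; rewrite addSnnS scalerA -exprSr.
Qed.

Lemma fam_kills F r : fam F -> fam (fun nu => kills F r nu.1 nu.2).
Proof.
case=> sF stF; split=> [n|].
  elim: r n => // r IH n; split=> [a Ia|u v Ku Kv a Ia|b u Ku a Ia].
  - by rewrite scaler0; apply: submod0 (IH _).
  - by rewrite scalerDr; apply: (submodD (IH _)); [apply: Ku|apply: Kv].
  - by rewrite scalerA mulrC -scalerA; apply: (submodZ _ (IH _)); apply: Ku.
elim: r => [|r IH] a n u Ia Ku; first exact: stF.
by move=> b Ib; rewrite scalerA mulrC -scalerA; apply: IH => //; apply: Ku.
Qed.

Lemma pw_kills F L r n u : fam F -> (forall v, L v -> kills F r n v) -> pw L r u ->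
  F ((n + r)%N, u).
Proof.
move=> fF; elim: r n L u => [|r IH] n L u LK; first by rewrite addn0; apply: LK.
(* The innermost factor of [I] is absorbed into the submodule, since [kills] applies its first
   multiplier directly to the element. *)
rewrite -addSnnS -addn1 pw_add; apply: IH => v.
apply: (ideal_smul_min ((fam_kills r fF).1 _)) => a w Ia /LK; exact.
Qed.

Hypotheses (noethR : noetherian_ring R) (fgN : fin_gen_module N) (idI : is_ideal I).
Let sT : is_submodule (fun _ : N => True). Proof. by []. Qed.

(* Artin-Rees: apply the chain condition to the families agreeing with [F] up to
   degree [j] and generated by degree [j] afterwards. *)
Lemma rees_stable F : fam F -> (forall n u, F (n, u) -> pw (fun _ => True) n u) ->
  exists c, forall n d u, (c <= n)%N -> F ((n + d)%N, u) -> pw (fun v => F (n, v)) d u.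
Proof.
move=> fF FT; have [sF stF] := fF.
pose C j (nu : nat * N) := pw (fun v => F (minn nu.1 j, v)) (nu.1 - j) nu.2.
have CF j n u : C j (n, u) -> F (n, u).
  by move/(pw_min (n := minn n j) fF) => /(_ (fun v Fv => Fv)); rewrite /= minnE subnK ?leq_subr.
have incC j : subset_of (C j) (C j.+1).
  move=> [n u]; rewrite /C /=; have [lenj|ltjn] := leqP n j.
    have [-> ->] : (n - j = 0 /\ n - j.+1 = 0)%N by split; apply/eqP; rewrite subn_eq0 // leqW.
    by rewrite (minn_idPl (leqW lenj)).
  rewrite (minn_idPr ltjn) -(subnSK ltjn) -addn1 pw_add; apply: pwS.
  by apply: (ideal_smul_min (sF _)) => a v Ia; apply: stF.
have [j|//|p hp] := acc_rees noethR fgN idI (C := C).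
  split=> [|n u /CF /FT //]; split=> [n|a n u Ia]; first by apply: pw_submod; apply: sF.
  rewrite /C /=; have [lejn|ltnj] := leqP j n.
    rewrite (minn_idPr (leqW lejn)) subSn //; exact: mem_ideal_smul.
  have [-> ->] : (n - j = 0 /\ n.+1 - j = 0)%N by split; apply/eqP; rewrite subn_eq0 // ltnW.
  by rewrite (minn_idPl ltnj); apply: stF.
exists p => n d u lepn Fu.
have : C n ((n + d)%N, u).
  apply: (chain_le incC lepn); apply: (hp (n + d)%N); first exact: leq_trans (leq_addr d n).
  by rewrite /C /= minnn subnn.
by rewrite /C /= (minn_idPr (leq_addr d n)) addKn.
Qed.

(** By Artin-Rees, [H_n = I^r H_(n-r)] once [n - r] is large, and [I^r] carries [H_(n-r)] into
    [F_n]. *)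
Lemma kills_vanish F H r : fam H -> (forall n u, H (n, u) -> pw (fun _ => True) n u) ->
  fam F -> (forall n u, H (n, u) -> kills F r n u) ->
  exists c, forall n u, (c <= n)%N -> H (n, u) -> F (n, u).
Proof.
move=> fH HT fF HK; have [c hc] := rees_stable fH HT.
exists (c + r)%N => n u len Hu.
have lern : (r <= n)%N by apply: leq_trans len; apply: leq_addl.
rewrite -(subnK lern); apply: (pw_kills fF (HK _)); apply: hc; rewrite ?subnK //.
by rewrite leq_subRL // addnC.
Qed.

(** * Generic elements of [I] *)

Definition proper_subideal (p : R -> Prop) :=
  [/\ is_ideal p, subset_of p I & ~ subset_of I p].

Definition generic (Q : R -> Prop) := exists ps : seq (R -> Prop),
  (forall p, List.In p ps -> proper_subideal p) /\
  forall x, I x -> (forall p, List.In p ps -> ~ p x) -> Q x.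

Lemma generic_sub (Q Q' : R -> Prop) : (forall x, I x -> Q x -> Q' x) ->
  generic Q -> generic Q'.
Proof.
move=> QQ' [ps [psP hps]]; exists ps; split=> // x Ix px; exact/QQ'/hps.
Qed.

Lemma genericT : generic (fun _ => True).
Proof. by exists [::]; split. Qed.

Lemma generic_and (Q Q' : R -> Prop) : generic Q -> generic Q' ->
  generic (fun x => Q x /\ Q' x).
Proof.
move=> [ps [psP hps]] [ps' [psP' hps']]; exists (ps ++ ps'); split.
  by move=> p /List.in_app_iff[/psP|/psP'].
move=> x Ix px; split; [apply: hps|apply: hps'] => // p pin; apply: px.
  by apply/List.in_app_iff; left.
by apply/List.in_app_iff; right.
Qed.

Lemma generic_avoid p : proper_subideal p -> generic (fun x => ~ p x).
Proof.
move=> pp; exists [:: p]; split=> [q /= [<-|]//|x Ix px]; apply: px; by left.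
Qed.

(* Climb from [F] to [E] by adjoining [u] in [E_n] outside [F_n] with
   [p = {x in I | x u in F_(n+1)}] maximal. Then [p] is the colon of every element
   of the family generated by [u] that is not in [F], so for [x] not in [p]
   multiplication by [x] is injective on that layer, while if [p = I] the whole
   layer is killed by [I]. *)
Lemma generic_kills E F : fam E -> (forall n u, E (n, u) -> pw (fun _ => True) n u) ->
  fam F -> subset_of F E ->
  exists r, generic (fun x => forall n u, E (n, u) -> F (n.+1, x *: u) -> kills F r n u).
Proof.
move=> fE ET fF sFE.
pose P (L : nat * N -> Prop) :=
  fam L /\ forall n u, L (n, u) -> pw (fun _ => True) n u.
have PF : P F by split=> // n u /sFE /ET.
move: F PF sFE {fF}; apply: (acc_ind (P := P) (acc_rees noethR fgN idI)) => F [fF _] IH sFE.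
have [sEF|nsEF] := classic (subset_of E F).
  by exists 0%N; apply: generic_sub genericT => x _ _ n u /sEF.
have [sF stF] := fF.
pose cl n u x := I x /\ F (n.+1, x *: u).
pose X p := exists n u, [/\ E (n, u), ~ F (n, u) & p = cl n u].
have idX p : X p -> is_ideal p.
  have [I0 ID IM] := idI; move=> [n [u [_ _ ->]]]; split.
  - by split=> //; rewrite scale0r; apply: submod0 (sF _).
  - move=> a b [Ia Fa] [Ib Fb]; split; first exact: ID.
    by rewrite scalerDl; apply: (submodD (sF _)).
  - by move=> r a [Ia Fa]; split; [exact: IM|rewrite -scalerA; apply: (submodZ _ (sF _))].
have [|p [[n [u [Eu nFu ep]]] pmax]] := acc_max (acc_ideals noethR) idX.
  apply: NNPP => no; apply: nsEF => -[n u] Eu; apply: NNPP => nFu; apply: no.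
  by exists (cl n u), n, u.
(* The family generated by [u], taken as the intersection of all families containing it; this makes
   [Zcl] a matter of exhibiting one family. *)
pose Z (kv : nat * N) := forall L : nat * N -> Prop, fam L -> L (n, u) -> L kv.
have fZ : fam Z.
  split=> [k|a k v Ia Zv L fL Lu]; last by apply: fL.2 => //; apply: Zv.
  split=> [L fL Lu|v w Zv Zw L fL Lu|b v Zv L fL Lu].
  - exact: submod0 (fL.1 k).
  - by apply: (submodD (fL.1 k)); [apply: Zv|apply: Zw].
  - by apply: (submodZ _ (fL.1 k)); apply: Zv.
have Zcl b k v : F (n.+1, b *: u) -> Z (k, v) -> F (k.+1, b *: v).
  move=> Fbu /(_ (fun kv => F (kv.1.+1, b *: kv.2))); apply=> //; split=> [l|a l w Ia Fw].
    split=> /=; first by rewrite scaler0; apply: submod0 (sF _).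
      by move=> w w' Fw Fw'; rewrite scalerDr; apply: (submodD (sF _)).
    by move=> r w Fw; rewrite scalerA mulrC -scalerA; apply: (submodZ _ (sF _)).
  by rewrite /= scalerA mulrC -scalerA; apply: stF.
pose F' (kv : nat * N) := exists w y, [/\ F (kv.1, w), Z (kv.1, y) & kv.2 = w + y].
have sFF' : subset_of F F'.
  move=> [k w] Fw; exists w, 0; rewrite addr0; split=> //; exact: submod0 (fZ.1 k).
have fF' : fam F'.
  split=> [k|a k v Ia [w [y [Fw Zy /= ->]]]]; last first.
    exists (a *: w), (a *: y); rewrite scalerDr; split=> //; first exact: stF.
    exact: fZ.2.
  split=> [|v v' [w [y [Fw Zy /= ->]]] [w' [y' [Fw' Zy' /= ->]]]|r v [w [y [Fw Zy /= ->]]]].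
  - apply: sFF'; exact: submod0 (sF k).
  - exists (w + w'), (y + y'); rewrite addrACA; split=> //; first exact: (submodD (sF k)).
    exact: (submodD (fZ.1 k)).
  - exists (r *: w), (r *: y); rewrite scalerDr; split=> //; first exact: (submodZ _ (sF k)).
    exact: (submodZ _ (fZ.1 k)).
have sF'E : subset_of F' E.
  move=> [k v] [w [y [Fw Zy /= ->]]]; apply: (submodD (fE.1 k)); first exact: sFE.
  exact: Zy.
have F'u : F' (n, u).
  by exists 0, u; rewrite add0r; split=> //; apply: submod0 (sF n).
have [||r gr] := IH F' _ sFF' _ sF'E.
- by split=> // k v /sF'E /ET.
- by move=> /(_ _ F'u).
have [Ip|nIp] := classic (subset_of I p).
  exists r.+1; apply: generic_sub gr => x Ix + k v Ev Fxv => /(_ k v Ev (sFF' _ Fxv)) Kv.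
  suff: kills F (r + 1) k v by rewrite addn1.
  apply: kills_comp Kv => l z [w [y [Fw Zy /= ->]]] a Ia.
  rewrite scalerDr; apply: (submodD (sF _)); first exact: stF.
  by apply: Zcl Zy; move: (Ip a Ia); rewrite ep => -[].
exists r; have pp : proper_subideal p by split=> //; [apply: idX; exists n, u|rewrite ep => a []].
apply: generic_sub (generic_and gr (generic_avoid pp)) => x Ix [hx npx] k v Ev Fxv.
have inj l w : F' (l, w) -> F (l.+1, x *: w) -> F (l, w).
  move=> [w0 [y [Fw0 Zy /= ->]]] Fx; apply: (submodD (sF l)) => //; apply: NNPP => nFy.
  apply: npx; apply: (pmax (cl l y)); first by exists l, y; split=> //; apply: Zy.
    by rewrite ep => b [Ib Fb]; split=> //; apply: Zcl Zy.
  split=> //; have -> : x *: y = x *: (w0 + y) - x *: w0 by rewrite scalerDr addrC addKr.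
  by apply: (submodB (sF _)) => //; apply: stF.
(* The induction hypothesis only brings [I^r v] into [F']. Since [x] sends every multiple [a *: v]
   into [F], injectivity modulo [F] improves [F'] to [F] with the same [r]. *)
have := hx k v Ev (sFF' _ Fxv).
elim: (r) k v {Ev} Fxv => [|r' IHr] k v Fxv; first by move=> F'v; apply: inj.
move=> Kv a Ia; apply: IHr (Kv a Ia).
by rewrite scalerA mulrC -scalerA; apply: stF.
Qed.

End Powers.

(** * The colon formula for generic elements *)

Section Colon.
Variables (R : comNzRingType) (N : lmodType R) (I : R -> Prop) (M : N -> Prop).
Hypotheses (noethR : noetherian_ring R) (fgN : fin_gen_module N) (idI : is_ideal I).
Hypothesis sM : is_submodule M.
Local Notation pw := (pw I).
Local Notation fam := (fam I).

Let pwM n : is_submodule (pw M n). Proof. exact: pw_submod. Qed.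
Let pwMT n u : pw M n u -> pw (fun _ => True) n u. Proof. exact: pwS. Qed.
Let fam0 : fam (fun nu : nat * N => nu.2 = 0).
Proof.
split=> [n|a n u Ia]; last by move=> /= ->; rewrite scaler0.
by split=> [//|u v /= -> ->|r u /= ->]; rewrite ?addr0 ?scaler0.
Qed.
Let famM : fam (fun nu => M nu.2).
Proof. by split=> [n //|a n u _ /=]; apply: submodZ. Qed.

(** The multiples [b *: w] with [w] in [I^n L] already form a family. This recovers a preimage under
    [x0 ^+ e] after Artin-Rees. *)
Lemma pw_scale (L : N -> Prop) b n v : is_submodule L ->
  pw (fun v => exists w, L w /\ v = b *: w) n v -> exists w, pw L n w /\ v = b *: w.
Proof.
move=> sL; have fL := fam_pw I sL; pose F nv := exists w, pw L nv.1 w /\ nv.2 = b *: w.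
suff fF : fam F by move=> Lv; apply: (pw_min (n := 0) fF _ Lv).
split=> [k|a k u Ia [w [Lw /= ->]]]; last first.
  exists (a *: w); split; first exact: fL.2.
  by rewrite !scalerA mulrC.
split=> [|u u' [w [Lw /= ->]] [w' [Lw' /= ->]]|r u [w [Lw /= ->]]].
- by exists 0; rewrite scaler0; split=> //; apply: submod0 (fL.1 k).
- by exists (w + w'); rewrite scalerDr; split=> //; apply: (submodD (fL.1 k)).
- exists (r *: w); split; first exact: (submodZ _ (fL.1 k)).
  by rewrite !scalerA mulrC.
Qed.

(** Elements of [I^n M] that a power of [I] kills modulo the next layer lie in [I^(n+1) M] for large
    [n]; [generic_kills] shows that [u] is such an element. *)
Lemma superficial : exists c, generic I (fun x => forall n u, (c <= n)%N ->
  pw M c u -> pw M n.+1 (x *: u) -> pw M n u).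
Proof.
have fE := fam_pw I sM.
have fF : fam (fun nu => pw M nu.1.+1 nu.2).
  by split=> [n|a n u Ia Lu]; [apply: pwM|apply: mem_ideal_smul].
have [|r gr] := generic_kills noethR fgN idI fE (fun n u => @pwMT n u) fF.
  by move=> [n u]; apply: pw_le.
have fK := fam_kills r fF.
have fH : fam (fun nu => pw M nu.1 nu.2 /\ kills I (fun nu => pw M nu.1.+1 nu.2) r nu.1 nu.2).
  split=> [n|a n u Ia [Eu Ku]]; last by split; [apply: fE.2|apply: fK.2].
  split=> [|u v [Eu Ku] [Ev Kv]|b u [Eu Ku]].
  - by split; [apply: submod0 (fE.1 n)|apply: submod0 (fK.1 n)].
  - by split; [apply: (submodD (fE.1 n))|apply: (submodD (fK.1 n))].
  - by split; [apply: (submodZ _ (fE.1 n))|apply: (submodZ _ (fK.1 n))].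
have [|n u /= []//|c hc] := kills_vanish noethR fgN idI (r := r) fH _ fF.
  by move=> n u [/pwMT].
exists c; apply: generic_sub gr => x Ix hx n u /subnKC <- Mu.
(* Climb one layer at a time: the weaker membership of [x *: u] puts [u] in [I^(c+d) M], and [hc]
   then raises it by one. *)
elim: (n - c)%N => [|d IH]; first by rewrite addn0.
rewrite addnS => Mxu; have Mu' : pw M (c + d) u by apply: IH; apply: pw_le Mxu.
by apply: (hc (c + d)%N u (leq_addr d c)); split=> //; apply: hx.
Qed.

Lemma torsion_vanish r : exists c, forall n u, (c <= n)%N ->
  pw M n u -> kills I (fun nu => nu.2 = 0) r n u -> u = 0.
Proof.
have fE := fam_pw I sM; have fK := fam_kills r fam0.
have fH : fam (fun nu => pw M nu.1 nu.2 /\ kills I (fun nu => nu.2 = 0) r nu.1 nu.2).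
  split=> [n|a n u Ia [Eu Ku]]; last by split; [apply: fE.2|apply: fK.2].
  split=> [|u v [Eu Ku] [Ev Kv]|b u [Eu Ku]].
  - by split; [apply: submod0 (fE.1 n)|apply: submod0 (fK.1 n)].
  - by split; [apply: (submodD (fE.1 n))|apply: (submodD (fK.1 n))].
  - by split; [apply: (submodZ _ (fE.1 n))|apply: (submodZ _ (fK.1 n))].
have [|n u /= []//|c hc] := kills_vanish noethR fgN idI (r := r) fH _ fam0.
  by move=> n u [/pwMT].
by exists c => n u lecn Mu Ku; apply: (hc n u lecn).
Qed.

Lemma generic_torsion : exists r, generic I (fun x => forall j n (u : N),
  x ^+ j *: u = 0 -> kills I (fun nu => nu.2 = 0) (j * r) n u).
Proof.
have sT : is_submodule (fun _ : N => True) by [].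
have fE := fam_pw I sT.
have [//||r gr] := generic_kills noethR fgN idI fE _ fam0.
  by move=> [n u] /= ->; apply: submod0 (fE.1 n).
exists r; apply: generic_sub gr => x Ix hx; elim=> [|j IH] n u.
  by rewrite expr0 scale1r.
(* Each factor [x] costs [r] powers of [I]: [I^r] kills [x ^+ j *: u], so [x ^+ j] kills [I^r u], to
   which induction applies. *)
rewrite exprS -scalerA => xu0; rewrite mulSn.
apply: (kills_comp (F := fun nu => x ^+ j *: nu.2 = 0)) => [l v /IH //|].
apply: (kills_scale (F := fun nu => nu.2 = 0)).
apply: (kills_shift (F := fun nu => nu.2 = 0) (m := 0)) (hx 0%N _ _ xu0) => //.
Qed.

Lemma generic_saturation : exists r, generic I (fun x => forall u,
  M (x *: u) -> kills I (fun nu => M nu.2) r 0 u).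
Proof.
have sT : is_submodule (fun _ : N => True) by [].
have fE := fam_pw I sT.
(* [M] is cut down by [I^n N] to lie inside the Rees module; only degree 0 is used in the end. *)
have fF : fam (fun nu => pw (fun _ => True) nu.1 nu.2 /\ M nu.2).
  split=> [n|a n u Ia [Eu Mu]]; last by split; [apply: fE.2|apply: submodZ].
  split=> [|u v [Eu Mu] [Ev Mv]|b u [Eu Mu]].
  - by split; [apply: submod0 (fE.1 n)|apply: submod0 sM].
  - by split; [apply: (submodD (fE.1 n))|apply: submodD].
  - by split; [apply: (submodZ _ (fE.1 n))|apply: submodZ].
have [//||r gr] := generic_kills noethR fgN idI fE _ fF; first by move=> nu [].
exists r; apply: generic_sub gr => x Ix hx u Mxu.
apply: kills_shift (hx 0%N u _ _) => //; first by move=> i v [].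
by split=> //; apply: mem_ideal_smul.
Qed.

(** Used to fix the reference element [x0]; infinitude of the residue field provides it. *)
Hypothesis generic_ex : forall Q, generic I Q -> exists x, I x /\ Q x.

Lemma generic_colon : exists t, (0 < t)%N /\ generic I (fun x =>
  forall J : R -> Prop, J x -> subset_of J I -> forall n, (t <= n)%N ->
    set_eq (colon (pw M n) J) (submod_add (@annih R N J) (pw M n.-1))).
Proof.
have [c gS] := superficial; have [r gT] := generic_torsion.
have [s gM] := generic_saturation.
have gen := generic_and gS (generic_and gT gM).
have [x0 [Ix0 [_ [T0 _]]]] := generic_ex gen.
(* The first [s] factors [x0] bring [u] into [M], and the next [c] into [I^c M], where [superficial]
   applies. *)
pose e := (s + c)%N; pose Ns u := kills I (fun nu => M nu.2) s 0 u.
have [c0 hc0] := torsion_vanish (e * r).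
have fNs : is_submodule Ns := (fam_kills s famM).1 0%N.
have Ns_I a u : I a -> Ns u -> Ns (a *: u).
  by move=> Ia; apply: submodZ.
have fE := fam_pw I sM.
(* [A_n] is the intersection of [I^n M] with [x0^e Ns], to which Artin-Rees is applied; it does not
   involve [x]. *)
pose A (nu : nat * N) := pw M nu.1 nu.2 /\ exists u, Ns u /\ nu.2 = x0 ^+ e *: u.
have fA : fam A.
  split=> [n|a n u Ia [Eu [v [Nv /= ev]]]]; last first.
    split; first exact: fE.2.
    exists (a *: v); split; first exact: Ns_I.
    by rewrite /= ev !scalerA mulrC.
  split=> [|u v [Eu [u' [Nu eu]]] [Ev [v' [Nv ev]]]|b u [Eu [u' [Nu eu]]]].
  - split; first exact: submod0 (fE.1 n).
    by exists 0; rewrite scaler0; split=> //; apply: submod0.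
  - split; first exact: (submodD (fE.1 n)).
    by exists (u' + v'); rewrite scalerDr -eu -ev; split=> //; apply: submodD.
  - split; first exact: (submodZ _ (fE.1 n)).
    exists (b *: u'); split; first exact: submodZ.
    by move: eu => /= ->; rewrite !scalerA mulrC.
have [|h hh] := rees_stable noethR fgN idI fA; first by move=> n u [/pwMT].
(* The successor makes [n.-1] a true predecessor, called [n] from here on; the sum ensures that [n]
   and the later [d] are at least [c] and [c0]. *)
exists (h + s + c + c0).+1; split=> //.
apply: generic_sub gen => x Ix [Sx [Tx Mx]] J Jx JI [//|n]; rewrite ltnS => len u /=.
have lecn : (c <= n)%N by lia.
have lec0n : (c0 <= n)%N by lia.
split=> [Ju|[z [w [Jz Mw ->]]] a Ja]; last first.
  by rewrite scalerDr Jz // add0r; apply: mem_ideal_smul => //; apply: JI.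
have Nu : Ns u by apply: Mx; exact: (pw_le sM (leq0n n.+1) (Ju x Jx)).
have x0u : pw M (n + e) (x0 ^+ e *: u).
  apply: Sx; first exact: leq_trans (leq_addr _ _).
    rewrite /e addnC exprD -scalerA; apply: pw_pow => //.
    exact: (kills_pow Ix0 Nu).
  rewrite scalerA mulrC -scalerA -addSn addnC pw_add; apply: pw_pow => //.
  exact: Ju.
pose d := (n + c - h)%N.
have ned : (n + e = h + (d + s))%N by rewrite /d /e; lia.
have [w [Mw ew]] : exists w, pw M d w /\ x0 ^+ e *: u = x0 ^+ e *: w.
  have : pw (fun v => A (h, v)) (d + s) (x0 ^+ e *: u).
    apply: hh => //; rewrite -ned; split=> //; by exists u.
  move/(pwS (fun v => @proj2 _ _)) => /(pw_scale fNs)[w [Nw ->]]; exists w; split=> //.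
  by move: Nw; rewrite pw_add; apply: pwS => v; apply: (pw_kills (n := 0) famM).
have c0d : (c0 <= d)%N by rewrite /d; lia.
have cd : (c <= d)%N by rewrite /d; lia.
have Kz : kills I (fun nu => nu.2 = 0) (e * r) n (u - w).
  by apply: T0; rewrite scalerBr ew subrr.
have fK := fam_kills (e * r) fam0.
(* The difference lies in [I^c0 M] and is killed by [I^(e*r)], hence vanishes. *)
have xw : x *: u = x *: w.
  apply/eqP; rewrite -subr_eq0 -scalerBr; apply/eqP; apply: (hc0 c0) => //.
    rewrite scalerBr; apply: submodB => //.
      by apply: (pw_le sM (leqW lec0n)); apply: Ju.
    by apply: (pw_le sM c0d); apply: submodZ.
  apply: (submodZ _ (fK.1 c0)); apply: kills_shift Kz => //.
have Mw' : pw M n w.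
  apply: Sx => //; first by apply: pw_le Mw.
  by rewrite -xw; apply: Ju.
exists (u - w), w; split=> //; last by rewrite subrK.
move=> a Ja; apply: (hc0 n) => //; last exact: (submodZ _ (fK.1 n)).
rewrite scalerBr; apply: submodB => //; first by apply: (pw_le sM (leqnSn n)); apply: Ju.
exact: submodZ.
Qed.

End Colon.

(** * Nakayama's lemma *)

Section Local.
Variables (R : comNzRingType) (m : R -> Prop).
Hypotheses (noethR : noetherian_ring R) (locR : local_ring m).

(** If [1 - a] were not a unit, its ideal would lie in a maximal ideal, necessarily [m], giving [1]
    in [m]. *)
Lemma local_unit a : m a -> exists b, b * (1 - a) = 1.
Proof.
move=> ma; have [[[idm nm1] _] uniqm] := locR.
pose P (x : R) := exists b, x = b * (1 - a).
have idP : is_ideal P.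
  split=> [|_ _ [b ->] [c ->]|r _ [b ->]]; first by exists 0; rewrite mul0r.
    by exists (b + c); rewrite mulrDl.
  by exists (r * b); rewrite mulrA.
apply: NNPP => no.
have [||J [[[idJ nJ1] sPJ] Jmax]] := @acc_max _ _
    (fun L : R -> Prop => Defs.proper_ideal L /\ subset_of P L) (acc_ideals noethR).
- by move=> L [[]].
- by exists P; split=> //; split=> // -[b e]; apply: no; exists b.
have maxJ : maximal_ideal J.
  split=> // K idK sJK; have [K1|nK1] := classic (K 1).
    by right=> x; split=> // _; rewrite -[x]mulr1; case: idK => _ _; apply.
  left=> x; split; last exact: sJK.
  by apply: Jmax x => //; split=> // y /sPJ /sJK.
apply: nm1; have [_ mD _] := idm; rewrite -(subrK a 1); apply: mD => //.
by apply/(uniqm _ maxJ); apply: sPJ; exists 1; rewrite mul1r.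
Qed.

(** Induction on generators of [L] modulo [K]: writing [g] in [K + m L] gives [(1 - a) g] in [K]
    plus the span of the others, so [g] is redundant. *)
Lemma nakayama (N : lmodType R) (K L : N -> Prop) : is_submodule K -> is_submodule L ->
  fin_gen_submodule L -> (forall u, L u -> exists v, K v /\ ideal_smul m L (u - v)) ->
  subset_of L K.
Proof.
move=> sK sL [s sP] LKmL; have [[[[m0 mD mM] _] _] _] := locR.
have {sP} : (forall g, g \in s -> L g) /\
    forall u, L u -> exists v y, [/\ K v, gen_submod s y & u = v + y].
  split=> [g gs|u /sP su]; first by apply/sP; apply: mem_gen_submod.
  by exists 0, u; rewrite add0r; split=> //; apply: submod0.
elim: s => [|g s IH] [Ls LKs].
  by move=> u /LKs[v [_ [Kv [c ->] ->]]]; rewrite big_ord0 addr0.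
have sS := gen_submod_submodule s.
have {}LKs u : L u -> exists v a y, [/\ K v, gen_submod s y & u = v + (a *: g + y)].
  by move=> /LKs[v [_ [Kv /gen_submod_cons[a [y [sy ->]]] ->]]]; exists v, a, y.
pose Z z := exists v a y, [/\ K v, m a, gen_submod s y & z = v + (a *: g + y)].
have sZ : is_submodule Z.
  split=> [|_ _ [v [a [y [Kv ma sy ->]]]] [w [b [z [Kw mb sz ->]]]]
          |r _ [v [a [y [Kv ma sy ->]]]]].
  - exists 0, 0, 0; rewrite scale0r !addr0; split=> //; exact: submod0.
  - exists (v + w), (a + b), (y + z); split; [exact: submodD|exact: mD|exact: submodD|].
    by rewrite scalerDl addrACA; congr (_ + _); rewrite addrACA.
  - exists (r *: v), (r * a), (r *: y); split; [exact: submodZ|exact: mM|exact: submodZ|].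
    by rewrite !scalerDr scalerA.
have mLZ : subset_of (ideal_smul m L) Z.
  apply: ideal_smul_min => // a u ma /LKs[v [b [y [Kv sy ->]]]].
  exists (a *: v), (b * a), (a *: y); split; [exact: submodZ|exact: mM|exact: submodZ|].
  by rewrite !scalerDr scalerA mulrC.
have [v [y [Kv sy eg]]] : exists v y, [/\ K v, gen_submod s y & g = v + y].
  have [v0 [Kv0 /mLZ[v [a [y [Kv ma sy e]]]]]] := LKmL g (Ls g (mem_head g s)).
  have [b ba] := local_unit ma.
  exists (b *: (v0 + v)), (b *: y); split; [|exact: submodZ|].
    by apply: submodZ => //; apply: submodD.
  rewrite -scalerDr -[LHS]scale1r -ba -scalerA scalerBl scale1r; congr (_ *: _).
  apply/eqP; rewrite subr_eq -addrA [y + _]addrC -addrA -e addrC subrK //.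
apply: IH; split=> [h hs|u /LKs[w [a [z [Kw sz ->]]]]]; first by apply: Ls; rewrite inE hs orbT.
exists (w + a *: v), (a *: y + z); split.
- by apply: submodD => //; apply: submodZ.
- by apply: submodD => //; apply: submodZ.
- by rewrite eg scalerDr !addrA.
Qed.
End Local.

(** * Linear forms and Zariski open sets *)

Section Cotangent.
Variables (k : fieldType) (V : vectType k).
Local Notation d := (\dim (fullv : {vspace V})).
Implicit Types (c : {ffun 'I_d -> k}) (v w : V) (W : V -> Prop).

(** If no [{vspace V}] inside [W] exhausts it, each can be enlarged by a line, exceeding the
    dimension of [V]. *)
Lemma vspace_of_subspace W : W 0 -> (forall v w, W v -> W w -> W (v + w)) ->
  (forall a v, W v -> W (a *: v)) -> exists A : {vspace V}, forall v, W v <-> v \in A.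
Proof.
move=> W0 WD WZ; apply: NNPP => no.
suff /(_ d.+1)[A [_]] : forall n, exists A : {vspace V},
    (forall v, v \in A -> W v) /\ (n <= \dim A)%N.
  by rewrite ltnNge dimvS ?subvf.
elim=> [|n [A [AW len]]]; first by exists 0%VS; split=> // v; rewrite memv0 => /eqP ->.
have [v [Wv nAv]] : exists v, W v /\ v \notin A.
  apply: NNPP => no'; apply: no; exists A => v; split=> [Wv|]; last exact: AW.
  by apply: contraT => nAv; case: no'; exists v.
exists (A + <[v]>)%VS; split.
  by move=> _ /memv_addP[a Aa [_ /vlineP[b ->] ->]]; apply: WD; [apply: AW|apply: WZ].
apply: leq_ltn_trans len _; have sub : (A <= A + <[v]>)%VS by apply: addvSl.
rewrite ltn_neqAle dimvS // andbT (dimv_leqif_eq sub); apply: contra nAv => /eqP ->.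
exact: (subvP (addvSr A <[v]>)) (memv_line v).
Qed.

(** A form is stored as its finite coefficient function, which has the decidable equality needed for
    lists of forms. *)
Definition linear_form c v := \sum_i c i * vcoords v i.

Lemma linear_formD c v w a : linear_form c (v + a *: w) = linear_form c v + a * linear_form c w.
Proof.
rewrite /linear_form mulr_sumr -big_split; apply: eq_bigr => i _.
by rewrite /vcoords linearD linearZ /= mulrDr mulrCA.
Qed.

(** Some coordinate of [v0] minus its projection to the subspace is nonzero; that coordinate of
    [v - projv A v] is the form. *)
Lemma separating_form W v0 : W 0 -> (forall v w, W v -> W w -> W (v + w)) ->
  (forall a v, W v -> W (a *: v)) -> ~ W v0 ->
  exists c, (forall v, W v -> linear_form c v = 0) /\ linear_form c v0 != 0.
Proof.
move=> W0 WD WZ nW; have [A WA] := vspace_of_subspace W0 WD WZ.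
pose f := (\1 - projv A)%VF.
have fE v : f v = v - projv A v by rewrite add_lfunE opp_lfunE id_lfunE.
have : f v0 != 0.
  by rewrite fE subr_eq0; apply/eqP => e; apply: nW; apply/WA; rewrite e memv_proj.
rewrite {1}(coord_vbasis (memvf (f v0))) => nz.
have [i nzi] : exists i, coord (vbasis fullv) i (f v0) != 0.
  apply: NNPP => no; case/eqP: nz; apply: big1 => i _.
  have [->|nzi] := eqVneq (coord (vbasis fullv) i (f v0)) 0; first by rewrite scale0r.
  by case: no; exists i.
pose c := [ffun j : 'I_d => coord (vbasis fullv) i (f (vbasis fullv)`_j)].
exists c; have formE v : linear_form c v = coord (vbasis fullv) i (f v).
  rewrite [in RHS](coord_vbasis (memvf v)) !linear_sum /=.
  by apply: eq_bigr => j _; rewrite ffunE /vcoords mulrC !linearZ.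
split=> [v /WA Av|]; last by rewrite formE.
by rewrite formE fE projv_id // subrr linear0.
Qed.

(** On the line [v + t *: w] each form vanishes for at most one [t], and an infinite field has a [t]
    to spare. *)
Lemma common_nonzero (cs : seq {ffun 'I_d -> k}) : infinite_type k ->
  (forall c, c \in cs -> exists v, linear_form c v != 0) ->
  exists v, forall c, c \in cs -> linear_form c v != 0.
Proof.
move=> infk; elim: cs => [|c0 cs IH] csP; first by exists 0.
have [|v vP] := IH; first by move=> c ccs; apply: csP; rewrite inE ccs orbT.
have [w wP] := csP c0 (mem_head _ _).
(* A form vanishing at [w] contributes the harmless value 0, division by zero being 0; it is
   constant on the line and nonzero at [v]. *)
pose bad := [seq - linear_form c v / linear_form c w | c <- c0 :: cs].
have [t tP] : exists t, t \notin bad.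
  apply: NNPP => no; apply: infk; exists bad => t.
  by apply: contraT => nt; case: no; exists t.
exists (v + t *: w) => c cin; rewrite linear_formD.
have [cw0|cw] := eqVneq (linear_form c w) 0.
  rewrite cw0 mulr0 addr0; apply: vP; move: cin; rewrite inE => /orP[/eqP ec|//].
  by move: wP; rewrite -ec cw0 eqxx.
apply: contra tP; rewrite addrC addr_eq0 => /eqP e.
by apply/mapP; exists c; rewrite // -e mulfK.
Qed.

Definition form_poly c : {mpoly k[d]} := \sum_i c i *: 'X_i.

Lemma form_polyE c v : (form_poly c).@[vcoords v] = linear_form c v.
Proof.
rewrite /form_poly raddf_sum; apply: eq_bigr => i _ /=.
by rewrite mevalZ mevalXU.
Qed.

(** The product of the forms is a single polynomial defining the set. *)
Lemma nonzero_open (cs : seq {ffun 'I_d -> k}) :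
  zariski_open (fun v => forall c, c \in cs -> linear_form c v != 0).
Proof.
exists (fun q => q = \prod_(c <- cs) form_poly c) => v.
have prodE : (\prod_(c <- cs) form_poly c).@[vcoords v] = \prod_(c <- cs) linear_form c v.
  by rewrite rmorph_prod; apply: eq_bigr => c _; apply: form_polyE.
split=> [vP|[_ [-> /eqP]]].
  exists (\prod_(c <- cs) form_poly c); split=> //; apply/eqP; rewrite prodE.
  by rewrite prodf_seq_neq0; apply/allP => c /vP.
by rewrite prodE prodf_seq_neq0 => /allP.
Qed.

End Cotangent.

(** * From generic properties to open subsets of [I/mI] *)

Section GenericOpen.
Variables (R : comNzRingType) (m : R -> Prop) (k : fieldType) (pi : {rmorphism R -> k}).
Variables (I : R -> Prop) (V : vectType k) (phi : R -> V).
Hypotheses (noethR : noetherian_ring R) (locR : local_ring m) (resP : residue_map m pi).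
Hypotheses (infk : infinite_type k) (idI : is_ideal I) (cotP : cotangent_map m pi I phi).

(** By Nakayama [p + m I] is not [I], so the image of [p] is a proper subspace and some nonzero form
    vanishes on it. *)
Lemma subideal_form p : proper_subideal I p -> exists c,
  (exists v, linear_form c v != 0) /\ forall x, p x -> linear_form c (phi x) = 0.
Proof.
move=> [idp pI nIp]; have [phiD phiZ phi_onto phi_ker] := cotP.
have [I0 ID IM] := idI; have [p0 pD pM] := idp; have [pi_onto _] := resP.
pose W v := exists a, p a /\ phi a = v.
have [v0 nW] : exists v, ~ W v.
  apply: NNPP => no; apply: nIp.
  have fgI : fin_gen_submodule (N := R^o) I by apply: noethR.
  apply: (nakayama (N := R^o) noethR locR idp idI fgI) => a Ia.
  have [b [pb eab]] : W (phi a) by apply: NNPP => nWa; apply: no; exists (phi a).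
  have IN : I (- b) by rewrite -mulN1r; apply/IM/pI.
  exists b; split=> //; apply/(phi_ker (a - b)); first exact: ID.
  by rewrite phiD // -mulN1r phiZ ?eab; [rewrite rmorphN1 scaleN1r subrr|apply: pI].
have [|v w [a [pa <-]] [b [pb <-]]|a v [b [pb <-]]||c [cW cv0]] :=
  separating_form (W := W) (v0 := v0).
- by exists 0; split=> //; rewrite -(mulr0 0) phiZ // rmorph0 scale0r.
- by exists (a + b); split; [apply: pD|apply: phiD; apply: pI].
- have [r <-] := pi_onto a; exists (r * b); split; [exact: pM|exact/phiZ/pI].
- by [].
exists c; split; first by exists v0.
by move=> x px; apply: cW; exists x.
Qed.

Lemma generic_open Q : generic I Q -> exists U : V -> Prop,
  [/\ zariski_open U, exists v, U v & forall x, I x -> U (phi x) -> Q x].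
Proof.
move=> [ps [psP hps]].
have [cs [csP hcs]] : exists cs : seq {ffun 'I_(\dim (fullv : {vspace V})) -> k},
    (forall c, c \in cs -> exists v, linear_form c v != 0) /\
    forall x, (forall c, c \in cs -> linear_form c (phi x) != 0) ->
      forall p, List.In p ps -> ~ p x.
  elim: ps psP {hps} => [|p ps IH] psP; first by exists [::]; split.
  have [|cs [csP hcs]] := IH; first by move=> q qps; apply: psP; right.
  have [c [cnz cp]] := subideal_form (psP p (or_introl erefl)).
  exists (c :: cs); split=> [c'|x xP q].
    by rewrite inE => /orP[/eqP -> //|]; apply: csP.
  case=> [<- px|]; first by have := xP c (mem_head _ _); rewrite cp // eqxx.
  by apply: hcs => c' c'cs; apply: xP; rewrite inE c'cs orbT.
exists (fun v => forall c, c \in cs -> linear_form c v != 0); split.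
- exact: nonzero_open.
- exact: common_nonzero.
- by move=> x Ix xU; apply: hps => //; apply: hcs.
Qed.

Lemma generic_ex Q : generic I Q -> exists x, I x /\ Q x.
Proof.
move=> /generic_open[U [_ [v Uv] UQ]]; have [_ _ /(_ v)[x [Ix ex]] _] := cotP.
by exists x; split=> //; apply: UQ; rewrite ?ex.
Qed.

End GenericOpen.

Theorem theorem2p2 (R : comNzRingType) (m : R -> Prop) (k : fieldType)
  (pi : {rmorphism R -> k}) (N : lmodType R) (I : R -> Prop) (M : N -> Prop) :
  noetherian_ring R -> local_ring m -> residue_map m pi -> infinite_type k ->
  is_ideal I -> fin_gen_module N -> is_submodule M -> fin_gen_submodule M ->
  forall (V : vectType k) (phi : R -> V), cotangent_map m pi I phi ->
  exists t : nat, (0 < t)%N /\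
    exists U : V -> Prop, [/\ zariski_open U, (exists v, U v) &
      forall x, I x -> U (phi x) ->
      forall J : R -> Prop, is_ideal J -> J x -> subset_of J I ->
      forall n : nat, (t <= n)%N ->
        set_eq (colon (ideal_smul (ideal_pow I n) M) J)
               (submod_add (@annih R N J) (ideal_smul (ideal_pow I n.-1) M))].
Proof.
move=> noethR locR resP infk idI fgN sM _ V phi cotP.
have [t [t0 gt]] := generic_colon noethR fgN idI sM
  (generic_ex noethR locR resP infk idI cotP).
(* One [U] serves all [J] and [n], since both are quantified inside the generic property. *)
exists t; split=> //; have [U [openU neU UQ]] := generic_open noethR locR resP infk idI cotP gt.
exists U; split=> // x Ix Ux J _ Jx JI n len u.
have pwE := pw_ideal_pow I _ sM; split=> [Ju|[z [w [Jz Mw ->]]] a Ja].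
  have [|z [w [Jz Mw ->]]] := (UQ x Ix Ux J Jx JI n len u).1.
    by move=> a Ja; apply/pwE; apply: Ju.
  by exists z, w; split=> //; apply/pwE.
apply/pwE; apply: (UQ x Ix Ux J Jx JI n len _).2 => //.
by exists z, w; split=> //; apply/pwE.
Qed.
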